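(* Let $X$ be a real locally convex Hausdorff topological vector space with topological dual $Y=X^\prime$, and let $C\subseteq X$ be a pointed cone. Let $\mathscr{G}:=\{G_x: x\in X\setminus\{0\}\}$. Then the following are equivalent: (i) $C$ is convex; (ii) $J\notin\mathscr{K}(C)$ for all $H,K,J\in\mathscr{G}$ such that $H,K\notin\mathscr{K}(C)$ and $J\subseteq H\cup K$; (iii) there exists a family $\mathscr{K}\subseteq\mathcal{P}(Y)$ representing $C$ with the property that, for all $H,K,J\in\mathscr{G}$ with $J\subseteq H\cup K$: if $\mathcal{P}(H)\cap\mathscr{K}=\emptyset$ and $\mathcal{P}(K)\cap\mathscr{K}=\emptyset$, then $\mathcal{P}(J)\cap\mathscr{K}=\emptyset$.
   Context: Write $\langle x,y\rangle:=y(x)$ for $x\in X$, $y\in Y=X^\prime$, and $\mathcal{P}(S)$ for the power set of $S$. A nonempty subset $C\subseteq X$ is a cone if $\lambda C\subseteq C$ for all real $\lambda>0$; it is pointed if $0\in C$. Given a nonempty family $\mathscr{K}\subseteq\mathcal{P}(Y)$ of nonempty sets, a cone $C\subseteq X$ is represented by $\mathscr{K}$ (equivalently, $\mathscr{K}$ represents $C$) if $C=C_{\mathscr{K}}$, where $$C_{\mathscr{K}}:=\{x\in X:\ \forall K\in\mathscr{K},\ \exists y\in K,\ \langle x,y\rangle\ge 0\}.$$ For $x\in X$ let $G_x:=\{y\in Y:\langle x,y\rangle<0\}$, and for a pointed cone $C$ let $\mathscr{K}(C):=\{G_x: x\in X\setminus C\}$. Convention for the degenerate case $C=X$: $\mathscr{K}(X)$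 is understood to be $\{\emptyset\}$, and $X$ is by convention also represented by $\{\emptyset\}$. *)

(* Defs.v *)
From HB Require Import structures.
From mathcomp Require Import all_boot all_order all_algebra.
From mathcomp Require Import boolp classical_sets reals convex topology.
From mathcomp Require Import normedtype.

Set Implicit Arguments.
Unset Strict Implicit.
Unset Printing Implicit Defensive.

Import Order.TTheory GRing.Theory Num.Theory.
Import numFieldNormedType.Exports.

Local Open Scope classical_set_scope.
Local Open Scope ring_scope.

Definition subsets (T : Type) (S : set T) : set (set T) := [set A | A `<=` S].

Section Duality.
Context {R : realType} {X : tvsType R}.

Definition dual : Type := {y : {linear X -> R^o} | continuous (y : X -> R^o)}.

Definition pairing (x : X) (y : dual) : R := sval y x.

Definition is_cone (C : set X) : Prop :=
  C !=set0 /\ forall l : R, 0 < l -> [set l *: x | x in C] `<=` C.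

Definition is_pointed_cone (C : set X) : Prop := is_cone C /\ C 0.

Definition cone_of (KK : set (set dual)) : set X :=
  [set x | forall K, KK K -> exists2 y, K y & 0 <= pairing x y].

(* The second disjunct is the degenerate convention for the whole space:
   [set set0] is a nonempty family, but not a family of nonempty sets. *)
Definition represents (KK : set (set dual)) (C : set X) : Prop :=
  [/\ KK !=set0, (forall K, KK K -> K !=set0) & C = cone_of KK]
  \/ (KK = [set set0] /\ C = setT).

Definition neg_side (x : X) : set dual := [set y | pairing x y < 0].

Definition neg_sides : set (set dual) :=
  [set neg_side x | x in ~` [set 0]].

(* [set neg_side x | x in ~` C] would be the empty family for C = setT;
   by convention it is replaced by [set set0]. *)
Definition canonical_family (C : set X) : set (set dual) :=
  if `[< C = setT >] then [set set0] else [set neg_side x | x in ~` C].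

End Duality.

Arguments dual {R} X.
Arguments neg_sides {R} X.

(* Main.v *)
Require Import Defs.
From HB Require Import structures.
From mathcomp Require Import all_boot all_order all_algebra.
From mathcomp Require Import boolp classical_sets reals convex topology.
From mathcomp Require Import normedtype interval_inference.
From mathcomp Require Import ring lra.

Set Implicit Arguments.
Unset Strict Implicit.
Unset Printing Implicit Defensive.

Import Order.TTheory GRing.Theory Num.Theory.
Import numFieldNormedType.Exports.

Local Open Scope classical_set_scope.
Local Open Scope ring_scope.

(** The argument reads inclusions between the half-spaces [neg_side x] as
    membership in a finitely generated cone.  By Farkas' lemma for the duality
    between X and its dual, [neg_side z] is included in
    [neg_side x `|` neg_side y] exactly when z is a conic combination of x and
    y ([neg_side_subU] and [neg_side_subU_conic]).  When C is not the whole
    space, [neg_side x] belongs to the canonical family exactly when x is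
    outside C ([canonical_family_neg_side]), so the second condition says that
    C contains the conic combinations of any two of its points; for a pointed
    cone this is convexity.

    That [neg_side x] determines whether x is in C comes from the case x = y of
    Farkas' lemma, which gives more: if [neg_side z] is included in
    [neg_side x], then z is a nonnegative multiple of x.  If moreover z is
    outside the pointed cone C, the two half-spaces are equal and x is outside
    C too ([neg_side_sub_notin]).  Therefore the canonical family represents C,
    and [neg_side x] includes a member of it only if it is itself a member.
    This is why the second condition yields the third one with the canonical
    family.  Conversely, for any family representing C by [cone_of],
    [neg_side x] includes no member of the family exactly when x is in C
    ([subsets_neg_sideP]), so the third condition yields convexity by
    [neg_side_subU_conic], the easy half of the dictionary.

    Farkas' lemma needs that continuous functionals separate points, which is
    where local convexity and the Hausdorff property enter.  This is the
    Hahn-Banach theorem, proved here without extending partial functionals: by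
    Zorn's lemma every sublinear functional dominates a minimal sublinear one,
    and a minimal sublinear functional is linear.  Applied to the gauge of a
    convex neighbourhood of 0 avoiding x, it gives a continuous functional
    that does not vanish at x.  The two-vector Farkas lemma then follows from
    the one-vector case after projecting along one of the vectors, so that no
    closedness of finitely generated cones has to be established. *)

(** * Convex combinations *)

Section ConvexCombinations.
Context {R : realType} {E : lmodType R}.

Lemma convex_setP (A : set E) :
  convex_set A <->
  forall x y (s t : R), A x -> A y -> 0 <= s -> 0 <= t -> s + t = 1 ->
    A (s *: x + t *: y).
Proof.
split=> [cA x y s t Ax Ay s0 t0 st1|cA x y l].
  have s1 : s <= 1 by rewrite -st1 lerDl.
  have := cA x y (Itv01 s0 s1) (mem_set Ax) (mem_set Ay).
  by rewrite inE; suff -> : t = 1 - s by []; rewrite -st1 addrC addKr.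
rewrite !inE => Ax Ay; apply: cA => //; first by rewrite subr_ge0.
by rewrite addrC subrK.
Qed.

End ConvexCombinations.

(** * The Hahn-Banach theorem for sublinear functionals *)

Section Sublinear.
Context {R : realType} {E : lmodType R}.
Implicit Types p q f : E -> R.

Definition sublinear p : Prop :=
  (forall x y, p (x + y) <= p x + p y) /\
  (forall (a : R) x, 0 <= a -> p (a *: x) = a * p x).

Lemma sublinear0 p : sublinear p -> p 0 = 0.
Proof. by case=> _ /(_ 0 0 (lexx 0)); rewrite scale0r mul0r. Qed.

Lemma sublinear_geN p x : sublinear p -> - p (- x) <= p x.
Proof.
move=> sp; have [/(_ x (- x)) + _] := sp.
by rewrite subrr sublinear0// => ?; lra.
Qed.

(** An infimum of sets F x is sublinear as soon as the sets are compatible with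
    the operations up to a smaller element.  Gauges, flattenings and lower
    bounds of chains are all sublinear for this reason.  An inequality for
    positive scalars suffices: applied to l and to its inverse it gives
    equality, and applied to 2 and 1/2 at the origin it gives the value 0
    there. *)
Lemma sublinear_inf (F : E -> set R) :
  (forall x, F x !=set0) -> (forall x, has_lbound (F x)) ->
  (forall x y a b, F x a -> F y b -> exists2 c, F (x + y) c & c <= a + b) ->
  (forall x (l a : R), 0 < l -> F x a ->
    exists2 c, F (l *: x) c & c <= l * a) ->
  sublinear (fun x => inf (F x)).
Proof.
move=> F0 lF FD FZ.
have le_inf x a c : F x c -> c <= a -> inf (F x) <= a.
  by move=> Fc; apply: le_trans; exact: ge_inf.
have infZ_le (l : R) x : 0 < l -> inf (F (l *: x)) <= l * inf (F x).
  move=> l0; rewrite mulrC -ler_pdivrMr//; apply: lb_le_inf => // a Fa.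
  rewrite ler_pdivrMr// mulrC.
  by have [c + ca] := FZ _ _ _ l0 Fa => /le_inf; exact.
have inf0 : inf (F 0) = 0.
  have := infZ_le 2 0 (ltr0Sn _ _).
  have half_gt0 : (0 : R) < 2^-1 by rewrite invr_gt0.
  have := infZ_le _ 0 half_gt0; rewrite !scaler0; lra.
split=> [x y|a x] /=.
  rewrite -lerBlDr; apply: lb_le_inf => // a Fa.
  rewrite lerBlDr -lerBlDl; apply: lb_le_inf => // b Fb.
  by rewrite lerBlDl; have [c + cab] := FD _ _ _ _ Fa Fb => /le_inf; exact.
rewrite le_eqVlt => /predU1P[<-|a0]; first by rewrite scale0r mul0r.
apply/eqP; rewrite eq_le infZ_le//=.
have ia0 : 0 < a^-1 by rewrite invr_gt0.
have := infZ_le _ (a *: x) ia0.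
by rewrite scalerA mulVf ?gt_eqF// scale1r ler_pdivlMl.
Qed.

(** For sublinear p, this is the largest functional below p that has slope p y
    in the direction y. *)
Definition flatten_along p y (x : E) : R :=
  inf [set p (x + t *: y) - t * p y | t in [set t | 0 <= t]].

Section FlattenAlong.
Context {p} (sp : sublinear p) (y : E).

Let F x := [set p (x + t *: y) - t * p y | t in [set t | 0 <= t]].

Let lbF x : lbound (F x) (- p (- x)).
Proof.
move=> _ [t /= t0 <-]; have [pD pZ] := sp.
rewrite -pZ//; have := pD (x + t *: y) (- x).
by rewrite addrAC subrr add0r => ?; lra.
Qed.

Lemma flatten_along_sublinear : sublinear (flatten_along p y).
Proof.
have [pD pZ] := sp.
apply: sublinear_inf => [x|x|x z _ _ [s /= s0 <-] [t /= t0 <-]|].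
- by exists (p (x + 0 *: y) - 0 * p y), 0 => /=.
- by exists (- p (- x)); exact: lbF.
- exists (p (x + z + (s + t) *: y) - (s + t) * p y).
    by exists (s + t) => //=; exact: addr_ge0.
  by rewrite scalerDl addrACA; have := pD (x + s *: y) (z + t *: y); lra.
- move=> x l _ l0 [t /= t0 <-].
  exists (p (l *: x + (l * t) *: y) - l * t * p y).
    by exists (l * t) => //=; exact: mulr_ge0 (ltW l0) t0.
  by rewrite -scalerA -scalerDr (pZ _ _ (ltW l0)) mulrBr mulrA lexx.
Qed.

Lemma flatten_along_le t x : 0 <= t ->
  flatten_along p y x <= p (x + t *: y) - t * p y.
Proof.
by move=> t0; apply: ge_inf; [exists (- p (- x)); exact: lbF|exists t].
Qed.

Lemma flatten_along_le0 x : flatten_along p y x <= p x.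
Proof.
by have := flatten_along_le x (lexx 0); rewrite scale0r addr0 mul0r subr0.
Qed.

Lemma flatten_along_le1 x : flatten_along p y x <= p (x + y) - p y.
Proof. by have := flatten_along_le x ler01; rewrite scale1r mul1r. Qed.

End FlattenAlong.

(** Flattening a minimal p changes nothing, and the flattened functional is at
    most [p (x + y) - p y]; this is the superadditivity that p lacks. *)
Lemma minimal_sublinear_linear p : sublinear p ->
  (forall q, sublinear q -> (forall x, q x <= p x) -> q = p) ->
  linear (p : E -> R^o).
Proof.
move=> sp minp; have [pD pZ] := sp.
have pDE x y : p (x + y) = p x + p y.
  apply/eqP; rewrite eq_le pD/= -lerBrDr.
  rewrite -[in leLHS](minp (flatten_along p y)); first exact: flatten_along_le1.
  - exact: flatten_along_sublinear.
  - exact: flatten_along_le0.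
have pN x : p (- x) = - p x.
  by apply/eqP; rewrite -addr_eq0 addrC -pDE subrr sublinear0.
move=> a x y; rewrite pDE; congr (_ + _).
have [a0|a0] := leP 0 a; first exact: pZ.
by rewrite -[a]opprK scaleNr pN pZ ?oppr_ge0 ?ltW// -mulNr.
Qed.

(** Zorn's lemma applies because a chain of sublinear functionals below p is
    bounded below pointwise: q x >= - q (- x) >= - p (- x). *)
Lemma exists_minimal_sublinear p : sublinear p ->
  exists f, [/\ sublinear f, (forall x, f x <= p x) &
    forall q, sublinear q -> (forall x, q x <= f x) -> q = f].
Proof.
move=> sp; pose P q := sublinear q /\ forall x, q x <= p x.
pose T := {q : E -> R | P q}.
pose below (q q' : T) := `[< forall x, sval q' x <= sval q x >].
have [q|q r s /asboolP qr /asboolP rs|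
    [q ?] [r ?] /asboolP/= qr /asboolP/= rq|A Atot|f fmin] := @Zorn T below.
- by apply/asboolP.
- by apply/asboolP => x; exact: le_trans (rs x) (qr x).
- by apply/eq_exist/funext => x; apply/eqP; rewrite eq_le rq qr.
- have [[q0 Aq0]|A0] := pselect (A !=set0); last first.
    by exists (exist P p (conj sp (fun=> lexx _))) => q Aq; case: A0; exists q.
  pose F x : set R := [set sval q x | q in A].
  have lbF x : lbound (F x) (- p (- x)).
    move=> _ [q _ <-]; have [sq qp] := svalP q.
    by apply: le_trans (sublinear_geN x sq); rewrite lerN2.
  have infF_le (q : T) x : A q -> inf (F x) <= sval q x.
    by move=> Aq; apply: ge_inf; [exists (- p (- x))|exists q].
  have sF : sublinear (fun x => inf (F x)).
    apply: sublinear_inf => [x|x|x y _ _ [q Aq <-] [r Ar <-]|].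
    - by exists (sval q0 x), q0.
    - by exists (- p (- x)).
    (* the smaller of two members of the chain works for both points *)
    - have [/asboolP qr|/asboolP rq] := Atot _ _ Aq Ar.
      + exists (sval r (x + y)); first by exists r.
        have [[rD _] _] := svalP r; have := qr x; have := rD x y; lra.
      + exists (sval q (x + y)); first by exists q.
        have [[qD _] _] := svalP q; have := rq y; have := qD x y; lra.
    - move=> x l _ l0 [q Aq <-]; exists (sval q (l *: x)); first by exists q.
      by have [[_ qZ] _] := svalP q; rewrite qZ// ltW.
  have Fp x : inf (F x) <= p x.
    by have [_ /(_ x)] := svalP q0; apply: le_trans; exact: infF_le.
  exists (exist P _ (conj sF Fp)) => q Aq; apply/asboolP => x.
  exact: infF_le.
have [sf fp] := svalP f; exists (sval f); split=> // q sq qf.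
have qp x : q x <= p x := le_trans (qf x) (fp x).
by rewrite -(fmin (exist P q (conj sq qp)))//; apply/asboolP.
Qed.

(** A minimal functional is taken below the flattening of p along x0 rather than
    below p itself: the flattening is at most - p x0 at - x0, which forces
    the value p x0 at x0. *)
Lemma hahn_banach_sublinear p x0 : sublinear p ->
  exists f, [/\ linear (f : E -> R^o), (forall x, f x <= p x) & f x0 = p x0].
Proof.
move=> sp; have := flatten_along_sublinear sp x0.
move=> /exists_minimal_sublinear[f [sf fp fmin]].
have lf := minimal_sublinear_linear sf fmin.
have f_le x : f x <= p x := le_trans (fp x) (flatten_along_le0 sp _ _).
exists f; split=> //; apply/eqP; rewrite eq_le f_le/=.
have fN : f (- x0) = - f x0.
  by have := lf (-1) x0 0; rewrite addr0 (sublinear0 sf) addr0 !scaleN1r.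
rewrite -lerN2 -fN; apply: le_trans (fp _) _.
apply: le_trans (flatten_along_le1 sp _ _) _.
by rewrite addNr sublinear0// sub0r.
Qed.

End Sublinear.

(** * Gauges of convex sets *)

Section Gauge.
Context {R : realType} {E : lmodType R}.
Implicit Types U : set E.

Definition gauge U (x : E) : R := inf [set t | 0 < t /\ U (t^-1 *: x)].

Let lb0 U x : lbound [set t : R | 0 < t /\ U (t^-1 *: x)] 0.
Proof. by move=> t [/ltW]. Qed.

Lemma gauge_sublinear U : convex_set U ->
  (forall x, exists2 t : R, 0 < t & U (t^-1 *: x)) -> sublinear (gauge U).
Proof.
move=> /convex_setP cU absU; apply: sublinear_inf => [x|x|x y a b|x l a l0].
- by have [t t0 Ut] := absU x; exists t.
- by exists 0; exact: lb0.
- move=> [a0 Ua] [b0 Ub]; exists (a + b) => //; split; first exact: addr_gt0.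
  have ab0 : 0 < a + b by exact: addr_gt0.
  have -> : (a + b)^-1 *: (x + y) =
      (a / (a + b)) *: (a^-1 *: x) + (b / (a + b)) *: (b^-1 *: y).
    rewrite !scalerA scalerDr; congr (_ *: _ + _ *: _).
      by field; rewrite !gt_eqF.
    by field; rewrite !gt_eqF.
  apply: cU => //; try exact: divr_ge0 (ltW _) (ltW _).
  by rewrite -mulrDl divff// gt_eqF.
- move=> [a0 Ua]; exists (l * a) => //; split; first exact: mulr_gt0.
  by rewrite scalerA invfM mulrAC mulVf ?gt_eqF// mul1r.
Qed.

Lemma gauge_le1 U x : U x -> gauge U x <= 1.
Proof.
by move=> Ux; apply: ge_inf; [exists 0; exact: lb0|rewrite /= invr1 scale1r].
Qed.

(** If x = t u with u in U and t < 1, then x is on the segment from 0 to u. *)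
Lemma gauge_ge1 U x : convex_set U ->
  (forall x, exists2 t : R, 0 < t & U (t^-1 *: x)) ->
  U 0 -> ~ U x -> 1 <= gauge U x.
Proof.
move=> /convex_setP cU absU U0 Ux; apply: lb_le_inf.
  by have [t t0 Ut] := absU x; exists t.
move=> t [t0 Ut]; rewrite leNgt; apply/negP => t1; apply: Ux.
have := cU _ _ t (1 - t) Ut U0 (ltW t0).
rewrite subr_ge0 scaler0 addr0 scalerA divff ?gt_eqF// scale1r; apply.
  exact: ltW.
by rewrite addrC subrK.
Qed.

End Gauge.

(** * The dual of a Hausdorff locally convex space separates points *)

Section DualSpace.
Context {R : realType} {X : tvsType R}.

(** A one-sided bound on U bounds the absolute value on the intersection of U
    and - U, and linearity scales this bound down to any e > 0. *)
Lemma linear_bounded_continuous (f : X -> R^o) (U : set X) :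
  linear f -> nbhs 0 U -> (forall u, U u -> f u <= 1) -> continuous f.
Proof.
move=> lf U0 fU x.
have fD u (a : R) v : f (u + a *: v) = f u + a * f v.
  by rewrite addrC lf addrC.
have f0 : f 0 = 0 by have := fD 0 1 0; rewrite scaler0 addr0; lra.
apply/cvgrPdist_le => e e0.
have V0 : nbhs (0 : X) (U `&` -%R @` U) by apply: filterI => //; exact: nbhs0N.
have /(nbhsT x) := nbhs0Z (lt0r_neq0 e0) V0; apply: filterS.
move=> _ [_ [v [Uv [w Uw vw]] <-] <-] /=.
rewrite fD opprD addNKr normrN normrM (gtr0_norm e0) ler_piMr ?(ltW e0)//.
have fw : f w = - f v.
  by have := fD 0 (-1) v; rewrite add0r f0 scaleN1r -vw opprK => ->; lra.
by rewrite ler_norml fU// lerNl -fw fU.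
Qed.

Lemma dual_of_linear (f : X -> R^o) : linear f -> continuous f ->
  exists y : dual X, forall x, pairing x y = f x.
Proof.
move=> lf cf; pose g : {linear X -> R^o} := HB.pack f
  (GRing.isLinear.Build _ _ _ _ f lf).
by exists (exist (fun y : {linear X -> R^o} => continuous y) g cf).
Qed.

Lemma absorbing_nbhs0 (U : set X) (x : X) : nbhs 0 U ->
  exists2 t : R, 0 < t & U (t^-1 *: x).
Proof.
move=> U0; have /= := @scale_continuous R X (0, x) U.
rewrite scale0r => /(_ U0)[/= [B1 B2] /= [/nbhs_ballP[e /= e0 eB1] B2x] BU].
exists (e / 2)^-1; first by rewrite invr_gt0 divr_gt0.
rewrite invrK; apply: (BU (e / 2, x)); split=> /=; last exact: nbhs_singleton.
apply: eB1; rewrite -ball_normE /= sub0r normrN gtr0_norm ?divr_gt0//.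
by rewrite ltr_pdivrMr// ltr_pMr// ltr1n.
Qed.

Lemma convex_nbhs0_avoiding (x : X) : hausdorff_space X -> x != 0 ->
  exists U : set X, [/\ convex_set U, nbhs 0 U & ~ U x].
Proof.
move=> hX x0; have : 0 != x by rewrite eq_sym.
move=> /(hausdorff_accessible hX)[A [oA]].
rewrite !inE => A0 Ax; have [B cB [Bo /(_ 0 A)]] := @locally_convex R X.
case=> [|b [Bb b0] bA].
  exact: open_nbhs_nbhs.
exists b; split; [by apply: cB; rewrite inE| |by move/bA].
by apply: open_nbhs_nbhs; split=> //; exact: Bo.
Qed.

(** Hahn-Banach for the gauge of U: domination by the gauge bounds f by 1 on U,
    hence f is continuous, while the gauge is at least 1 at x. *)
Lemma dual_separates (x : X) : hausdorff_space X -> x != 0 ->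
  exists y : dual X, pairing x y = 1.
Proof.
move=> hX x0; have [U [cU U0 Ux]] := convex_nbhs0_avoiding hX x0.
have absU z := absorbing_nbhs0 z U0.
have := hahn_banach_sublinear x (gauge_sublinear cU absU).
move=> [f [lf fU fx]].
have fx1 : 1 <= f x.
  by rewrite fx; apply: gauge_ge1 => //; exact: nbhs_singleton.
have f_cont : continuous f.
  apply: (linear_bounded_continuous lf U0) => u Uu.
  exact: le_trans (fU u) (gauge_le1 Uu).
have fx0 : f x != 0 by rewrite gt_eqF// (lt_le_trans ltr01 fx1).
have [|v|y yE] := @dual_of_linear (fun v => (f x)^-1 * f v).
- by move=> a u v; rewrite lf mulrDr; congr (_ + _); exact: mulrCA.
- by apply: cvgMl_tmp; exact: f_cont.
- by exists y; rewrite yE mulVf.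
Qed.
End DualSpace.

(** * Farkas' lemma for one and two vectors *)

Section Farkas.
Context {R : realType} {X : tvsType R}.
Implicit Types (x y z : X) (f g : dual X).

Lemma pairingDl x y f : pairing (x + y) f = pairing x f + pairing y f.
Proof. exact: linearD. Qed.

Lemma pairingZl (a : R) x f : pairing (a *: x) f = a * pairing x f.
Proof. exact: linearZ. Qed.

Lemma pairingBl x y f : pairing (x - y) f = pairing x f - pairing y f.
Proof. exact: linearB. Qed.

Lemma pairing0l f : pairing 0 f = 0.
Proof. exact: linear0. Qed.

Lemma dual_lincomb (a b : R) f g :
  exists h, forall x, pairing x h = a * pairing x f + b * pairing x g.
Proof.
apply: dual_of_linear => [c u v|x].
  by rewrite !pairingDl !pairingZl -[c *: _]/(c * _); ring.
by apply: cvgD; apply: cvgMl_tmp; [exact: (svalP f)|exact: (svalP g)].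
Qed.

Hypothesis hX : hausdorff_space X.

(** For x <> 0 this says that the value 1 is reached at x.  The equation below
    also makes sense for x = 0, so that the projection along x and the two
    Farkas lemmas need no case distinction. *)
Lemma dual_normalized x : exists2 f, 0 <= pairing x f & pairing x f *: x = x.
Proof.
have [->|/(dual_separates hX)[f fx]] := eqVneq x 0.
  have [||f _] := @dual_of_linear R X (fun=> 0).
  - by move=> a u v; rewrite scaler0 addr0.
  - by move=> u; exact: cvg_cst.
  - by exists f; rewrite ?scaler0// pairing0l.
by exists f; rewrite fx ?scale1r.
Qed.

Definition proj_along x f z := z - pairing z f *: x.

(** When f is normalized at x, the functional h vanishes at x; a hypothesis on
    all functionals, applied to such h only, becomes one modulo x. *)
Lemma dual_proj_along x f g :
  exists h, forall z, pairing z h = pairing (proj_along x f z) g.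
Proof.
have [h hE] := dual_lincomb 1 (- pairing x g) g f.
by exists h => z; rewrite hE pairingBl pairingZl; ring.
Qed.

Lemma proj_along_self x f : pairing x f *: x = x -> proj_along x f x = 0.
Proof. by rewrite /proj_along => ->; rewrite subrr. Qed.

(** If z were not a multiple of x, some functional would vanish at x and not at
    the projection of z along x; it or its opposite would contradict the
    hypothesis. *)
Lemma farkas1 x z :
  (forall f, 0 <= pairing x f -> 0 <= pairing z f) ->
  exists2 a : R, 0 <= a & z = a *: x.
Proof.
move=> xz; have [f fx0 fx] := dual_normalized x.
exists (pairing z f); first exact: xz.
apply/eqP; rewrite -subr_eq0; apply/negPn/negP => /(dual_separates hX)[g gz].
have [h hE] := dual_proj_along x f g.
have [k kE] := dual_lincomb (-1) 0 h h.
have := xz k; rewrite !kE !hE proj_along_self// pairing0l gz; lra.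
Qed.

(** One sign out of two: modulo x, the hypothesis on x and y becomes the
    one-vector hypothesis on y. *)
Let farkas2_half x y z :
  (forall f, 0 <= pairing x f -> 0 <= pairing y f -> 0 <= pairing z f) ->
  exists a b : R, 0 <= b /\ z = a *: x + b *: y.
Proof.
move=> xyz; have [f fx0 fx] := dual_normalized x.
have [g|b b0 zE] := @farkas1 (proj_along x f y) (proj_along x f z).
  have [h hE] := dual_proj_along x f g.
  by rewrite -!hE; apply: xyz; rewrite hE proj_along_self// pairing0l.
exists (pairing z f - b * pairing y f), b; split=> //.
rewrite scalerBl -scalerA -addrA [- _ + _]addrC -scalerBr.
by rewrite -[y - _]/(proj_along x f y) -zE addrC subrK.
Qed.

(** The half lemma and its mirror image give two expressions of z, each with
    one nonnegative coefficient.  If neither is conic, comparing them shows that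
    y is a nonnegative multiple of x, and the one-vector lemma applies. *)
Lemma farkas2 x y z :
  (forall f, 0 <= pairing x f -> 0 <= pairing y f -> 0 <= pairing z f) ->
  exists a b : R, [/\ 0 <= a, 0 <= b & z = a *: x + b *: y].
Proof.
move=> xyz; have [a [b [b0 zE]]] := farkas2_half xyz.
have [|c [d [d0 zE']]] := @farkas2_half y x z.
  by move=> f ? ?; exact: xyz.
have [a0|a0] := leP 0 a; first by exists a, b.
have [c0|c0] := leP 0 c; first by exists d, c; split=> //; rewrite addrC.
have yE : y = ((d - a) / (b - c)) *: x.
  apply: (@scalerI _ _ (b - c)); first by rewrite gt_eqF//; lra.
  rewrite scalerA mulrC divfK ?gt_eqF//; last lra.
  rewrite !scalerBl; apply/eqP.
  by rewrite subr_eq addrAC eq_sym subr_eq addrC -zE' zE addrC.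
have r0 : 0 <= (d - a) / (b - c) by rewrite divr_ge0//; lra.
have [f fx|e e0 ->] := @farkas1 x z.
  by apply: xyz => //; rewrite yE pairingZl mulr_ge0.
by exists e, 0; rewrite scale0r addr0.
Qed.

Lemma neg_side_neq0 x : x != 0 -> neg_side x !=set0.
Proof.
move=> /(dual_separates hX)[f fx]; have [g gE] := dual_lincomb (-1) 0 f f.
by exists g; rewrite /neg_side /= gE fx; lra.
Qed.

Lemma neg_sideZ (a : R) x : 0 < a -> neg_side (a *: x) = neg_side x.
Proof.
by move=> a0; apply/funext => f; rewrite /neg_side /= pairingZl pmulr_rlt0.
Qed.

Lemma neg_side_sub x z : neg_side z `<=` neg_side x ->
  exists2 a : R, 0 <= a & z = a *: x.
Proof.
move=> zx; apply: farkas1 => f; rewrite !leNgt; apply: contra.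
exact: zx.
Qed.

Lemma neg_side_subU x y z : neg_side z `<=` neg_side x `|` neg_side y ->
  exists a b : R, [/\ 0 <= a, 0 <= b & z = a *: x + b *: y].
Proof.
move=> zxy; apply: farkas2 => f; rewrite !leNgt => /negP fx /negP fy.
by apply/negP => /zxy[].
Qed.

End Farkas.

(** * Half-spaces and the canonical family of a pointed cone *)

Section PointedCones.
Context {R : realType} {X : tvsType R}.
Implicit Types (x y z : X) (C : set X).

Lemma pointed_coneZ C (a : R) x : is_pointed_cone C -> 0 <= a -> C x ->
  C (a *: x).
Proof.
move=> [[_ CZ] C0]; rewrite le_eqVlt => /predU1P[<-|a0] Cx.
  by rewrite scale0r.
by apply: (CZ a a0); exists x.
Qed.

Lemma convex_coneD C x y : is_pointed_cone C -> convex_set C -> C x -> C y ->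
  C (x + y).
Proof.
move=> pC /convex_setP cC Cx Cy.
have -> : x + y = (2 : R) *: (2^-1 *: x + 2^-1 *: y).
  by rewrite -scalerDr scalerA divff ?scale1r ?pnatr_eq0.
by apply: pointed_coneZ => //; apply: cC => //; lra.
Qed.

Lemma neg_side_subU_conic x y (a b : R) : 0 <= a -> 0 <= b ->
  neg_side (a *: x + b *: y) `<=` neg_side x `|` neg_side y.
Proof.
move=> a0 b0 f; rewrite /neg_side /= pairingDl !pairingZl => zf.
have [xf|xf] := ltP (pairing x f) 0; [by left|right].
rewrite ltNge; apply/negP => yf; move: zf; rewrite ltNge => /negP; apply.
by rewrite addr_ge0// mulr_ge0.
Qed.

(** The right-hand side is membership of x in [cone_of KK], so the
    half-spaces including no member of KK are those of the points of the cone
    that KK represents. *)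
Lemma subsets_neg_sideP KK x :
  subsets (neg_side x) `&` KK = set0 <->
  forall K, KK K -> exists2 f, K f & 0 <= pairing x f.
Proof.
split=> [xKK K KKK|xKK].
  apply: contrapT => Kx; suff : (subsets (neg_side x) `&` KK) K by rewrite xKK.
  split=> // f Kf; rewrite /neg_side /= ltNge; apply/negP => xf.
  by apply: Kx; exists f.
rewrite -subset0 => K [Kx /xKK[f /Kx]]; rewrite /neg_side /=.
by move=> xf; rewrite leNgt xf.
Qed.

Lemma canonical_family_setT : canonical_family (setT : set X) = [set set0].
Proof. by rewrite /canonical_family asboolT. Qed.

Lemma canonical_familyE C : C <> setT ->
  canonical_family C = [set neg_side x | x in ~` C].
Proof. by move=> CT; rewrite /canonical_family asboolF. Qed.

Hypothesis hX : hausdorff_space X.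

(** By the one-vector Farkas lemma z is a nonnegative multiple of x; the factor
    is not 0, because 0 is in C and z is not. *)
Lemma neg_side_sub_notin C x z : is_pointed_cone C -> ~ C z ->
  neg_side z `<=` neg_side x -> neg_side z = neg_side x /\ ~ C x.
Proof.
move=> pC Cz /(neg_side_sub hX)[a a0 zE]; split; last first.
  by move=> Cx; apply: Cz; rewrite zE; exact: pointed_coneZ.
rewrite zE neg_sideZ// lt_neqAle a0 andbT eq_sym; apply/eqP => a_eq0.
by apply: Cz; rewrite zE a_eq0 scale0r; case: pC.
Qed.

Lemma canonical_family_neg_side C x : is_pointed_cone C -> C <> setT ->
  canonical_family C (neg_side x) <-> ~ C x.
Proof.
move=> pC CT; rewrite canonical_familyE//.
split=> [[z Cz zx]|Cx]; last by exists x.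
by have [] := @neg_side_sub_notin _ x _ pC Cz; rewrite zx.
Qed.

(** A half-space that includes a member of the canonical family is equal to it,
    so including a member amounts to being one. *)
Lemma subsets_neg_side_canonical C x : is_pointed_cone C -> C <> setT ->
  subsets (neg_side x) `&` canonical_family C = set0 <-> C x.
Proof.
move=> pC CT; split=> [xC|Cx].
  apply: contrapT => /(canonical_family_neg_side x pC CT) Cx.
  suff : (subsets (neg_side x) `&` canonical_family C) (neg_side x).
    by rewrite xC.
  by split=> // f.
rewrite -subset0 canonical_familyE// => K [Kx [z Cz zK]].
rewrite -{}zK in Kx; by have [] := neg_side_sub_notin pC Cz Kx.
Qed.

Lemma canonical_family_represents C : is_pointed_cone C ->
  represents (canonical_family C) C.
Proof.
move=> pC; have [->|CT] := pselect (C = setT).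
  by right; rewrite canonical_family_setT.
left; split.
- have [x Cx] : exists x, ~ C x.
    by apply/existsNP => CT'; apply: CT; apply/seteqP; split.
  by exists (neg_side x); apply/canonical_family_neg_side.
- rewrite canonical_familyE// => _ [x Cx <-]; apply: neg_side_neq0 => //.
  by apply: contra_notN Cx => /eqP ->; case: pC.
- apply/funext => x; apply/propext.
  by rewrite -(subsets_neg_side_canonical x pC CT) subsets_neg_sideP.
Qed.

End PointedCones.

(** * Convexity of a pointed cone in terms of its representing families *)

Theorem theorem3p2 (R : realType) (X : tvsType R) (hX : hausdorff_space X)
    (C : set X) (hC : is_pointed_cone C) :
  [<-> convex_set C;
       forall H K J : set (dual X),
         neg_sides X H -> neg_sides X K -> neg_sides X J ->
         ~ canonical_family C H -> ~ canonical_family C K ->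
         J `<=` H `|` K -> ~ canonical_family C J;
       exists2 KK : set (set (dual X)), represents KK C &
         forall H K J : set (dual X),
           neg_sides X H -> neg_sides X K -> neg_sides X J ->
           J `<=` H `|` K ->
           subsets H `&` KK = set0 -> subsets K `&` KK = set0 ->
           subsets J `&` KK = set0].
Proof.
split; [|split].
- move=> cC _ _ _ [x x0 <-] [y y0 <-] [z z0 <-].
  have [->|CT] := pselect (C = setT).
    rewrite canonical_family_setT => _ _ _ /= zE.
    by have [f] := neg_side_neq0 hX (introN eqP z0); rewrite zE.
  rewrite !canonical_family_neg_side// => /contrapT Cx /contrapT Cy.
  move=> /(neg_side_subU hX)[a [b [a0 b0 ->]]]; apply.
  by apply: convex_coneD => //; exact: pointed_coneZ.
- move=> hcan; exists (canonical_family C).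
    exact: canonical_family_represents.
  move=> _ _ _ [x x0 <-] [y y0 <-] [z z0 <-] zxy.
  have [CT|CT] := pselect (C = setT).
    rewrite CT canonical_family_setT => xC.
    (* every half-space includes the empty set, the only member of the family *)
    suff : (subsets (neg_side x) `&` [set set0]) set0 by rewrite xC.
    by split=> // f.
  rewrite !subsets_neg_side_canonical// => Cx Cy.
  have sides u : u <> 0 -> neg_sides X (neg_side u) by exists u.
  have := hcan _ _ _ (sides x x0) (sides y y0) (sides z z0).
  rewrite !canonical_family_neg_side// => zC; apply: contrapT.
  exact: zC.
- move=> [KK [[_ _ CE]|[_ ->]] hKK]; last by move=> ? ? ?; rewrite inE.
  have CP u : C u <-> subsets (neg_side u) `&` KK = set0.
    by rewrite subsets_neg_sideP CE.
  apply/convex_setP => x y s t Cx Cy s0 t0 _.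
  have sx := pointed_coneZ hC s0 Cx; have ty := pointed_coneZ hC t0 Cy.
  have [->|/eqP x0] := eqVneq x 0; first by rewrite scaler0 add0r.
  have [->|/eqP y0] := eqVneq y 0; first by rewrite scaler0 addr0.
  have [->|/eqP z0] := eqVneq (s *: x + t *: y) 0; first by case: hC.
  apply/CP; apply: (hKK (neg_side x) (neg_side y)); try exact/CP.
  + by exists x.
  + by exists y.
  + by exists (s *: x + t *: y).
  + exact: neg_side_subU_conic.
Qed.
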